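(* Let $s\geq 2$ and $r\geq 3$ be integers and let $G$ be a bipartite graph with an ordered bipartition $(X,Y)$ such that every vertex in $Y$ has degree at most $s$. Then, for all positive integers $n$, $$\mathrm{ex}(n,G_{X,Y}^{(r)})\leq Cn^{r-\frac{1}{s-1}},$$ where $C$ is a constant that depends only on $G$ (with its ordered bipartition) and $r$.
   Context: All graphs are finite. For an $r$-uniform hypergraph $H$, $\mathrm{ex}(n,H)$ denotes the largest number of edges in an $r$-uniform hypergraph on $n$ vertices containing no copy of $H$ (as a not necessarily induced subhypergraph). For a bipartite graph $G$ with ordered bipartition $(X,Y)$, $Y=\{y_1,\dots,y_m\}$, $G_{X,Y}^{(r)}$ is the $r$-uniform hypergraph whose vertex set is the union of pairwise disjoint sets $X,Y_1,\dots,Y_m$ with $|Y_1|=\dots=|Y_m|=r-1$, and whose edge set is $\{\{x\}\cup Y_i : x\in X,\ \{x,y_i\}\in E(G)\}$. *)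

(* Defs.v *)
From mathcomp Require Import all_boot.

Set Implicit Arguments.
Unset Strict Implicit.
Unset Printing Implicit Defensive.

Section Graphs.

Variables (V : finType) (e : rel V).

Definition simple_graph : Prop := symmetric e /\ irreflexive e.

Definition bipartition (X Y : {set V}) : Prop :=
  [/\ [disjoint X & Y], X :|: Y = [set: V] &
      forall u v, e u v ->
        (u \in X) && (v \in Y) || (u \in Y) && (v \in X)].

Definition degree (v : V) : nat := #|[set u | e v u]|.

End Graphs.

(* A hypergraph with vertex set the whole finite type W is given by its set
   of edges. *)
Section Hypergraphs.

Definition uniform (W : finType) (r : nat) (F : {set {set W}}) : bool :=
  [forall A in F, #|A| == r].

(* F contains a copy, not necessarily induced, of H. *)
Definition contains_copy (W U : finType)
    (H : {set {set W}}) (F : {set {set U}}) : bool :=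
  [exists f : {ffun W -> U},
    injectiveb f && [forall A in H, f @: A \in F]].

(* If H has no edges and n >= #|W|, no hypergraph on n vertices is H-free,
   and the maximum over the empty family is 0. *)
Definition ex (r n : nat) (W : finType) (H : {set {set W}}) : nat :=
  \max_(F : {set {set 'I_n}} | uniform r F && ~~ contains_copy H F) #|F|.

End Hypergraphs.

Section Expansion.

Variables (V : finType) (e : rel V) (X Y : {set V}) (r : nat).

(* The disjoint union of X and of the sets Y_y for y in Y, where Y_y consists
   of the r.-1 vertices inr (y, i). *)
Definition expansion_vertex : finType :=
  ({x : V | x \in X} + {y : V | y \in Y} * 'I_r.-1)%type.

Definition blowup (y : {y : V | y \in Y}) : {set expansion_vertex} :=
  [set inr (y, i) | i : 'I_r.-1].

Definition expansion : {set {set expansion_vertex}} :=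
  [set inl p.1 |: blowup p.2
     | p : {x : V | x \in X} * {y : V | y \in Y} & e (val p.1) (val p.2)].

End Expansion.

(* Main.v *)
(* Let F be a hypergraph without a copy of the expansion, and let nbr S be the
   set of x with x |: S an edge.  If every s-subset A of some large enough set
   of vertices were such that no M vertices meet all (r-1)-sets S with
   A \subset nbr S, then the sets Y_i could be embedded greedily.  So every
   m-set contains a "covered" s-set A, i.e. one whose common link is met by a set
   cover_of A of at most M vertices.  By supersaturation, for all but a small
   fraction of the pairs (S, x) with x in nbr S, the vertex x lies in at least
   c |nbr S|^(s-1) covered s-subsets of nbr S, and each of their covers meets S.
   Hence a quarter of the edges e have this property for all x in e.  In such an
   edge take x with |nbr (e :\ x)| maximal, then y in e :\ x that belongs to
   many of the covers, and then (as r >= 3) a facet R of e containing x and y.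
   By maximality, at least c' |nbr R|^(s-1) covered s-sets A satisfy x in A and
   y in cover_of A.  There are at most s M n^s such triples (A, x, y), and a pair
   (x, y) lies in at most n^(r-3) facets, so the power mean inequality over the
   facets R gives |F|^(s-1) = O(n^(r(s-1)-1)).
   Below k stands for s - 1. *)
Require Import Defs.
From mathcomp Require Import all_boot all_order all_algebra zify.
From mathcomp Require Import reals exp.
Set Implicit Arguments.
Unset Strict Implicit.
Unset Printing Implicit Defensive.

(** * Powers, binomial coefficients and power means *)

Lemma leq_exp_ffact n k : (n.+1 - k) ^ k <= n ^_ k.
Proof.
elim: k n => [|k IHk] [|n] //; rewrite subSS; first by rewrite sub0n exp0n.
by rewrite ffactSS expnS leq_mul // leq_subr.
Qed.

Lemma ffact_leq_exp n k : n ^_ k <= n ^ k.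
Proof.
elim: k n => [|k IHk] n //; rewrite ffactnS expnS leq_mul //.
apply: leq_trans (IHk _) _; case: k {IHk} => // k.
by rewrite leq_exp2r // leq_pred.
Qed.

Lemma bin_leq_exp n k : 'C(n, k) <= n ^ k.
Proof.
apply: leq_trans (ffact_leq_exp n k).
by rewrite -bin_ffact leq_pmulr // fact_gt0.
Qed.

Lemma exp_leq_bin n k : k.*2 <= n -> n ^ k <= 2 ^ k * k`! * 'C(n, k).
Proof.
move=> le_kn; rewrite -mulnA [k`! * _]mulnC bin_ffact.
apply: leq_trans (_ : 2 ^ k * (n.+1 - k) ^ k <= _).
  rewrite -expnMn; case: k le_kn => // k le_kn.
  by rewrite leq_exp2r //; lia.
by rewrite leq_mul // leq_exp_ffact.
Qed.

Lemma bin_trinomial d m s : s <= m -> m <= d ->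
  'C(d, m) * 'C(m, s) = 'C(d, s) * 'C(d - s, m - s).
Proof.
move=> le_sm le_md; have le_sd := leq_trans le_sm le_md.
apply/eqP; rewrite -(eqn_pmul2r (_ : 0 < s`! * (m - s)`! * (d - m)`!)); last first.
  by rewrite !muln_gt0 !fact_gt0.
have -> : 'C(d, m) * 'C(m, s) * (s`! * (m - s)`! * (d - m)`!) = d`!.
  by rewrite -(bin_fact le_md) -(bin_fact le_sm); lia.
have sub_md : m - s <= d - s by rewrite leq_sub2r.
have := bin_fact sub_md; rewrite subnBA // subnK // => Eds.
by rewrite -(bin_fact le_sd) -Eds; apply/eqP; lia.
Qed.

Lemma rearrangement2 a b k : a * b ^ k + b * a ^ k <= a ^ k.+1 + b ^ k.+1.
Proof.
wlog le_ab: a b / a <= b => [hw|].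
  by case/orP: (leq_total a b) => /hw //; rewrite addnC [X in _ <= X]addnC.
case: k => [|k]; first by rewrite !expn0 !expn1; lia.
have : a ^ k.+1 <= b ^ k.+1 by rewrite leq_exp2r.
rewrite !(expnS _ k.+1); move: (a ^ _) (b ^ _) => u v le_uv; nia.
Qed.

Lemma power_mean (I : finType) (A : {set I}) (a : I -> nat) k :
  (\sum_(i in A) a i) ^ k.+1 <= #|A| ^ k * \sum_(i in A) a i ^ k.+1.
Proof.
elim: k => [|k IHk].
  by rewrite expn1 expn0 mul1n; apply: leq_sum => i _; rewrite expn1.
rewrite expnS; apply: leq_trans (leq_mul (leqnn _) IHk) _.
rewrite mulnCA expnSr -mulnA leq_mul2l; apply/orP; right.
(* The product of the two sums is a double sum. Added to its copy with [i] and [j] exchanged, it is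
   bounded termwise by [rearrangement2]. *)
rewrite -(leq_pmul2l (_ : 0 < 2)) //.
set S := \sum_(i in A) a i; set Sk := \sum_(i in A) a i ^ k.+1.
have E : S * Sk = \sum_(i in A) \sum_(j in A) a i * a j ^ k.+1.
  by rewrite big_distrl; apply: eq_bigr => i _; rewrite big_distrr.
have E' : S * Sk = \sum_(i in A) \sum_(j in A) a j * a i ^ k.+1.
  by rewrite E exchange_big.
rewrite mul2n -addnn {1}E E' -big_split /=.
have -> : 2 * (#|A| * \sum_(i in A) a i ^ k.+2) =
    \sum_(i in A) \sum_(j in A) (a i ^ k.+2 + a j ^ k.+2).
  under [RHS]eq_bigr do rewrite big_split /= sum_nat_const.
  by rewrite big_split /= sum_nat_const -big_distrr /= mul2n addnn.
apply: leq_sum => i _; rewrite -big_split; apply: leq_sum => j _.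
exact: rearrangement2.
Qed.

(** * Supersets, supersaturation and double counting *)

Lemma card_supersets (T : finType) (A N : {set T}) p : A \subset N ->
  #|[set P : {set T} | [&& A \subset P, P \subset N & #|P| == p]]|
    <= 'C(#|N| - #|A|, p - #|A|).
Proof.
move=> sAN; rewrite -[#|A|](_ : #|N :&: A| = _); last by rewrite (setIidPr sAN).
rewrite -cardsD (setIidPr sAN) -cards_draws.
rewrite -(card_in_imset (f := fun P => P :\: A)).
  apply/subset_leq_card/subsetP => Q /imsetP[P].
  rewrite !inE => /and3P[sAP sPN /eqP cP] ->.
  by rewrite setSD //= cardsD (setIidPr sAP) cP.
move=> P Q; rewrite !inE => /andP[/setIidPr sAP _] /andP[/setIidPr sAQ _] eqD.
by rewrite -(setID P A) -(setID Q A) eqD sAP sAQ.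
Qed.

(** Double count pairs [A \subset P] with [A] bad and [P] an [m]-subset of [N]: each [P] holds at
    least one, each [A] lies in at most ['C(#|N| - s, m - s)], and [bin_trinomial] lets this factor
    cancel. *)
Lemma supersaturation (T : finType) (bad : pred {set T}) (N : {set T}) m s :
    s <= m -> m <= #|N| ->
    (forall P : {set T}, P \subset N -> #|P| = m ->
      exists A : {set T}, [/\ A \subset P, #|A| = s & bad A]) ->
  'C(#|N|, s)
    <= 'C(m, s) * #|[set A : {set T} | [&& A \subset N, #|A| == s & bad A]]|.
Proof.
move=> le_sm le_mN hbad; set D := [set A : {set T} | _].
have pos : 0 < 'C(#|N| - s, m - s) by rewrite bin_gt0 leq_sub2r.
rewrite -(leq_pmul2r pos) -bin_trinomial // mulnC -mulnA leq_mul2l.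
apply/orP; right; rewrite -cards_draws.
set M := [set P : {set T} | _].
apply: (@leq_trans (\sum_(P in M) \sum_(A in D | A \subset P) 1)).
  rewrite -sum1_card; apply: leq_sum => P; rewrite inE => /andP[sPN /eqP cP].
  have [A [sAP cA bA]] := hbad P sPN cP.
  by rewrite (bigD1 A) //= inE (subset_trans sAP sPN) cA eqxx bA sAP.
rewrite (exchange_big_dep (mem D)) /=; last by move=> P A _ /andP[].
rewrite -sum_nat_const; apply: leq_sum => A; rewrite inE => /and3P[sAN /eqP cA _].
rewrite sum1dep_card -cA; apply: leq_trans (card_supersets m sAN).
apply/subset_leq_card/subsetP => P; rewrite !inE.
by case/and3P => /andP[-> ->] _ ->.
Qed.

Lemma card_dep_pairs (I J : finType) (A : {set I}) (B : I -> {set J}) :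
  #|[set p : I * J | (p.1 \in A) && (p.2 \in B p.1)]| = \sum_(i in A) #|B i|.
Proof.
rewrite -sum1_card; under [RHS]eq_bigr do rewrite -sum1_card.
by rewrite pair_big_dep; apply: eq_bigl => p; rewrite inE.
Qed.

Lemma leq_card_bigcup (I T : finType) (A : {set I}) (B : I -> {set T}) :
  #|\bigcup_(i in A) B i| <= \sum_(i in A) #|B i|.
Proof.
elim/big_ind2: _ => [|n U k W leU leW|//]; first by rewrite cards0.
by apply: leq_trans (leq_add leU leW); rewrite cardsU leq_subr.
Qed.

(** * Counting edges when every [m]-set contains a covered set *)

Section Counting.

Variables (T : finType) (F : {set {set T}}) (r k m M : nat).

Definition nbr (S : {set T}) : {set T} := [set x | (x \notin S) && (x |: S \in F)].

Definition hits_link (A W : {set T}) : bool :=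
  [forall S : {set T}, (#|S| == r.-1) && (A \subset nbr S) ==> ~~ [disjoint S & W]].

Definition covered (A : {set T}) : bool :=
  [exists W : {set T}, (#|W| <= M) && hits_link A W].

(** The default [set0] arises only when [A] is not covered. *)
Definition cover_of (A : {set T}) : {set T} :=
  odflt set0 [pick W : {set T} | (#|W| <= M) && hits_link A W].

Lemma cover_ofP A : covered A -> #|cover_of A| <= M /\ hits_link A (cover_of A).
Proof.
rewrite /cover_of => /existsP[W hW]; case: pickP => [W' /andP[]//|] /(_ W).
by rewrite hW.
Qed.

Definition bad : {set {set T}} := [set A : {set T} | (#|A| == k.+1) && covered A].

Definition bad_at (x : T) (S : {set T}) : nat :=
  #|[set A in bad | (x \in A) && (A \subset nbr S)]|.

Definition bad_pair (x y : T) : nat :=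
  #|[set A in bad | (x \in A) && (y \in cover_of A)]|.

(* The value for which supersaturation in poor S contradicts poorness. *)
Definition rich_const : nat := 'C(m, k.+1) * (2 * r) ^ k * 2 ^ k.+1 * (k.+1)`!.

Definition poor (S : {set T}) : {set T} :=
  [set x in nbr S | rich_const * bad_at x S < #|nbr S| ^ k].

(** One pair of vertices of [R] pays for the [k]-th power of its codegree, so a sum over such [R]
    reduces to a sum of [bad_pair]. *)
Definition dense_facets : {set {set T}} :=
  [set R : {set T} | (#|R| == r.-1) &&
    [exists x in R, exists y in R :\ x,
       #|nbr R| ^ k <= rich_const * r * bad_pair x y]].

Hypotheses (hF : uniform r F) (hr : 3 <= r) (hk : 0 < k) (hm : k < m).
Hypothesis hbad : forall P : {set T}, #|P| = m ->
  exists A : {set T}, [/\ A \subset P, #|A| = k.+1 & covered A].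

Lemma card_edge e : e \in F -> #|e| = r.
Proof. by move/forall_inP: hF => /[apply] /eqP. Qed.

Lemma nbr_setD1 e x : e \in F -> x \in e -> x \in nbr (e :\ x).
Proof. by move=> eF xe; rewrite !inE eqxx setD1K. Qed.

(** Were [poor S] larger, supersaturation inside it would give so many bad sets that their
    incidences with poor vertices exceed what poorness allows. *)
Lemma card_poor S : 2 * r * #|poor S| <= #|nbr S| + 2 * r * (m + 2 * k.+1).
Proof.
rewrite leqNgt; apply/negP => hlt.
set b := #|poor S| in hlt *; set d := #|nbr S| in hlt *.
have hb : m + 2 * k.+1 < b.
  have r2 : 0 < 2 * r by lia.
  by rewrite -(ltn_pmul2l r2); apply: leq_ltn_trans hlt; apply: leq_addl.
set D := [set A : {set T} | [&& A \subset poor S, #|A| == k.+1 & A \in bad]].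
have hsat : 'C(b, k.+1) <= 'C(m, k.+1) * #|D|.
  apply: (supersaturation (bad := mem bad)) => //; first by lia.
  move=> P _ cP; have [A [sAP cA bA]] := hbad cP.
  by exists A; split; rewrite //= inE cA eqxx.
have hD : rich_const * (#|D| * k.+1) <= b * d ^ k.
  have -> : #|D| * k.+1 = \sum_(A in D) #|A|.
    rewrite -sum_nat_const; apply: eq_bigr => A.
    by rewrite inE => /and3P[_ /eqP].
  apply: (@leq_trans (rich_const * \sum_(x in poor S) bad_at x S)); last first.
    rewrite big_distrr -sum_nat_const /=; apply: leq_sum => x.
    by rewrite inE => /andP[_ /ltnW].
  rewrite leq_mul2l; apply/orP; right.
  under eq_bigr do rewrite -sum1_card.
  rewrite (exchange_big_dep (mem (poor S))) /=; last first.
    by move=> A x; rewrite inE => /andP[/subsetP sAp _] /sAp.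
  apply: leq_sum => x xp; rewrite sum1dep_card.
  apply/subset_leq_card/subsetP => A; rewrite !inE.
  case/andP=> /and3P[sAp -> /andP[_ ->]] -> /=.
  by apply: subset_trans sAp _; apply/subsetP => z; rewrite inE => /andP[].
(* The negated bound also gives [d < 2 * r * b], which trades [d] for [b]. *)
have lt_dk : b * d ^ k < b * (2 * r * b) ^ k.
  by rewrite ltn_pmul2l ?ltn_exp2r //; lia.
have hexp : b ^ k.+1 <= 2 ^ k.+1 * (k.+1)`! * 'C(b, k.+1).
  by apply: exp_leq_bin; lia.
(* The factors lost in [lt_dk], [hexp] and [hsat] multiply to [rich_const], so a number would be
   below itself. *)
have : rich_const * (#|D| * k.+1) < rich_const * k.+1 * #|D|.
  apply: leq_ltn_trans hD _; apply: leq_trans lt_dk _.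
  rewrite expnMn mulnCA -expnS.
  apply: leq_trans (leq_mul (leqnn _) hexp) _.
  apply: leq_trans (leq_mul (leqnn _) (leq_mul (leqnn _) hsat)) _.
  by rewrite /rich_const; nia.
by rewrite mulnA mulnAC ltnn.
Qed.

(** The pairs [(S, x)] inject into the incidences [(x |: S, x)] of edges and vertices. *)
Lemma sum_card_nbr :
  \sum_(S in [set S : {set T} | #|S| == r.-1]) #|nbr S| <= r * #|F|.
Proof.
rewrite -card_dep_pairs.
have -> : r * #|F| = \sum_(e in F) #|e|.
  rewrite mulnC -sum_nat_const; apply: eq_bigr => e eF.
  by rewrite card_edge.
rewrite -(card_dep_pairs F id).
rewrite -(card_in_imset (f := fun p : {set T} * T => (p.2 |: p.1, p.2))).
  apply/subset_leq_card/subsetP => _ /imsetP[[S x] + ->] /=.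
  by rewrite !inE /= => /and3P[_ _ ->]; rewrite eqxx.
move=> [S x] [S' x']; rewrite !inE /= => /and3P[_ xS _] /and3P[_ xS' _].
by case=> eqS eqx; subst x'; rewrite -(setU1K xS) -(setU1K xS') eqS.
Qed.

Definition poor_edges : {set {set T}} :=
  [set e in F | [exists x in e, x \in poor (e :\ x)]].

Lemma card_facets : #|[set S : {set T} | #|S| == r.-1]| <= #|T| ^ r.-1.
Proof. by rewrite card_draws bin_leq_exp. Qed.

(** A poor edge is [x |: S] with [x] in [poor S]. Sum [card_poor] over all [S] of size [r.-1], apply
    [sum_card_nbr] and cancel [r]. *)
Lemma card_poor_edges :
  2 * #|poor_edges| <= #|F| + 2 * (m + 2 * k.+1) * #|T| ^ r.-1.
Proof.
set L := [set S : {set T} | #|S| == r.-1].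
have hcov : #|poor_edges| <= \sum_(S in L) #|poor S|.
  apply: (@leq_trans (\sum_(S in L) #|[set x |: S | x in poor S]|)); last first.
    by apply: leq_sum => S _; apply: leq_imset_card.
  apply: leq_trans (leq_card_bigcup _ _).
  apply/subset_leq_card/subsetP => e; rewrite inE.
  case/andP=> eF /exists_inP[x xe xp]; apply/bigcupP; exists (e :\ x).
    by rewrite inE; have := card_edge eF; rewrite (cardsD1 x) xe => <-.
  by apply/imsetP; exists x; rewrite // setD1K.
have r0 : 0 < r by lia.
rewrite -(leq_pmul2l r0) mulnDr mulnA [r * 2]mulnC.
apply: leq_trans (leq_mul (leqnn (2 * r)) hcov) _.
rewrite big_distrr /=.
apply: (@leq_trans (\sum_(S in L) (#|nbr S| + 2 * r * (m + 2 * k.+1)))).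
  by apply: leq_sum => S _; apply: card_poor.
rewrite big_split /= sum_nat_const leq_add ?sum_card_nbr //.
have := card_facets; rewrite -/L; set N := _ ^ _ => hN.
by rewrite mulnC mulnA [r * (2 * _)]mulnA [r * 2]mulnC leq_mul.
Qed.

Lemma rich_edge_facet e : e \in F -> e \notin poor_edges ->
  exists2 R, R \in dense_facets & exists2 w, w \in nbr R & e = w |: R.
Proof.
move=> eF; rewrite inE eF /= => /exists_inPn hrich.
have /card_gt0P[x0 x0e] : 0 < #|e| by rewrite card_edge //; lia.
(* Maximality is what later permits replacing [e :\ x] by another facet of [e]. *)
have [x xe xmax] := @arg_maxnP _ x0 (fun x => x \in e) (fun x => #|nbr (e :\ x)|) x0e.
have cex : #|e :\ x| = r.-1 by have := card_edge eF; rewrite (cardsD1 x) xe => <-.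
have := hrich x xe; rewrite inE nbr_setD1 //= -leqNgt => hx.
(* As [e :\ x] lies in the common link of each [A] counted here, it meets [cover_of A]. *)
have hsum : bad_at x (e :\ x) <= \sum_(y in e :\ x) bad_pair x y.
  rewrite /bad_pair /bad_at; apply: leq_trans (leq_card_bigcup _ _).
  apply/subset_leq_card/subsetP => A; rewrite inE => /and3P[bA xA sA].
  have := bA; rewrite inE => /andP[_ /cover_ofP[_ /forallP/(_ (e :\ x))]].
  rewrite cex eqxx sA /= => /pred0Pn[y /andP[/= ye yA]].
  by apply/bigcupP; exists y; rewrite // inE bA xA.
(* Pigeonhole over the [r.-1] vertices of [e :\ x]. *)
have [y ye hy] : exists2 y, y \in e :\ x &
    bad_at x (e :\ x) <= r * bad_pair x y.
  apply/exists_inP; apply: contraT; rewrite negb_exists_in => /forall_inP hall.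
  have : \sum_(y in e :\ x) r * bad_pair x y <= \sum_(y in e :\ x) (bad_at x (e :\ x)).-1.
    by apply: leq_sum => y /hall; rewrite -ltnNge; lia.
  have /card_gt0P[y0 y0e] : 0 < #|e :\ x| by rewrite cex; lia.
  have := hall y0 y0e; rewrite -ltnNge.
  rewrite sum_nat_const -big_distrr /= cex; move: hsum; set B := bad_at _ _.
  by set s := \sum_(_ in _) _; nia.
have yex : y \in e by move: ye; rewrite !inE => /andP[].
(* Since [3 <= r], a vertex [w] other than [x] and [y] remains; deleting it keeps both in the
   facet. *)
have /card_gt0P[w] : 0 < #|e :\ x :\ y|.
  by have := cex; rewrite (cardsD1 y) ye; lia.
rewrite !inE => /and3P[wy wx we].
have cew : #|e :\ w| = r.-1 by have := card_edge eF; rewrite (cardsD1 w) we => <-.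
exists (e :\ w); last by exists w; rewrite ?nbr_setD1 // setD1K.
rewrite inE cew eqxx /=; apply/exists_inP; exists x; first by rewrite !inE eq_sym wx.
apply/exists_inP; exists y.
  by move: ye; rewrite !inE => /andP[-> ->]; rewrite eq_sym wy.
apply: leq_trans (_ : #|nbr (e :\ x)| ^ k <= _); first by rewrite leq_exp2r //; apply: xmax.
by apply: leq_trans hx _; rewrite -mulnA leq_mul.
Qed.

Lemma card_rich_edges : #|F :\: poor_edges| <= \sum_(R in dense_facets) #|nbr R|.
Proof.
apply: (@leq_trans (\sum_(R in dense_facets) #|[set x |: R | x in nbr R]|)); last first.
  by apply: leq_sum => R _; apply: leq_imset_card.
apply: leq_trans (leq_card_bigcup _ _).
apply/subset_leq_card/subsetP => e; rewrite in_setD => /andP[eP eF].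
have [R hR [w hw ->]] := rich_edge_facet eF eP.
by apply/bigcupP; exists R => //; apply/imsetP; exists w.
Qed.

(** Count triples by [A]: each bad set has [k.+1] choices of [x] and at most [M] of [y]. *)
Lemma sum_bad_pair : \sum_x \sum_y bad_pair x y <= k.+1 * M * #|T| ^ k.+1.
Proof.
have E x y : bad_pair x y = \sum_(A in bad) (x \in A) * (y \in cover_of A).
  rewrite /bad_pair -sum1_card big_mkcond /= [RHS]big_mkcond.
  by apply: eq_bigr => A _; rewrite !inE; case: (_ && covered A); case: (x \in A); case: (y \in _).
have -> : \sum_x \sum_y bad_pair x y = \sum_(A in bad) #|A| * #|cover_of A|.
  under eq_bigr do under eq_bigr do rewrite E.
  under eq_bigr do rewrite exchange_big /=.
  rewrite exchange_big /=; apply: eq_bigr => A _.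
  have card_sum (B : {set T}) : #|B| = \sum_x (x \in B).
    by rewrite -sum1_card big_mkcond; apply: eq_bigr => x _; case: (x \in B).
  rewrite !card_sum big_distrl; apply: eq_bigr => x _.
  by rewrite big_distrr.
apply: (@leq_trans (\sum_(A in bad) k.+1 * M)).
  apply: leq_sum => A; rewrite inE => /andP[/eqP -> /cover_ofP[cA _]].
  by rewrite leq_mul2l cA orbT.
rewrite sum_nat_const mulnC leq_mul2l; apply/orP; right.
apply: leq_trans (bin_leq_exp _ _); rewrite -card_draws.
by apply/subset_leq_card/subsetP => A; rewrite !inE => /andP[].
Qed.

Lemma sum_dense_facets :
  \sum_(R in dense_facets) #|nbr R| ^ k
    <= rich_const * r * (k.+1 * M) * #|T| ^ (r - 3 + k.+1).
Proof.
set c := rich_const * r.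
(* The witnessing pair is replaced by a sum over all pairs of distinct vertices of [R], so that
   summations can be exchanged. *)
apply: (@leq_trans (\sum_(R in dense_facets)
    \sum_x \sum_(y | [&& y != x, x \in R & y \in R]) c * bad_pair x y)).
  apply: leq_sum => R; rewrite inE.
  case/andP=> _ /exists_inP[x xR /exists_inP[y]]; rewrite !inE => /andP[yx yR] h.
  apply: leq_trans h _; rewrite (bigD1 x) //= (bigD1 y) /= ?yx ?xR //.
  by rewrite -addnA leq_addr.
rewrite exchange_big /=.
apply: (@leq_trans (\sum_x \sum_y c * bad_pair x y * #|T| ^ (r - 3))).
  apply: leq_sum => x _.
  rewrite (exchange_big_dep (fun y => y != x)) /=; last by move=> R y _ /andP[].
  rewrite big_mkcond; apply: leq_sum => y _; case: eqVneq => //= yx.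
  rewrite sum_nat_const mulnC leq_mul2l; apply/orP; right.
  apply: leq_trans (_ : 'C(#|[set: T]| - #|[set x; y]|, r.-1 - #|[set x; y]|) <= _).
    apply: leq_trans (card_supersets _ (subsetT _)).
    apply/subset_leq_card/subsetP => R; rewrite inE subsetT /= unfold_in.
    case/and3P; rewrite inE => /andP[-> _] xR yR; rewrite andbT.
    by apply/subsetP => z; rewrite !inE => /orP[] /eqP ->.
  rewrite cards2 eq_sym yx cardsT; apply: leq_trans (bin_leq_exp _ _) _.
  have -> : r.-1 - 2 = r - 3 by lia.
  case: (r - 3) => // j; by rewrite leq_exp2r // leq_subr.
under eq_bigr do rewrite -big_distrl -big_distrr /=.
rewrite -big_distrl -big_distrr /= addnC expnD mulnA leq_mul2r; apply/orP; right.
by rewrite -mulnA leq_mul2l sum_bad_pair orbT.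
Qed.

Lemma card_edges_bound : 0 < #|T| ->
  #|F| ^ k <= ((4 * (m + 2 * k.+1)) ^ k + 4 ^ k * (rich_const * r * (k.+1 * M)))
              * #|T| ^ (r * k - 1).
Proof.
move=> T0; set c := rich_const * r * _; rewrite mulnDl.
(* Below this threshold the first summand suffices; above it, fewer than three quarters of the edges
   are poor. *)
case: (leqP #|F| (4 * (m + 2 * k.+1) * #|T| ^ r.-1)) => hcase.
  apply: leq_trans (leq_addr _ _).
  apply: leq_trans (_ : (4 * (m + 2 * k.+1) * #|T| ^ r.-1) ^ k <= _).
    by rewrite leq_exp2r.
  rewrite expnMn -expnM leq_mul2l; apply/orP; right.
  by apply: leq_pexp2l => //; nia.
apply: leq_trans (leq_addl _ _).
have h4 : #|F| <= 4 * \sum_(R in dense_facets) #|nbr R|.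
  apply: leq_trans (leq_mul (leqnn 4) card_rich_edges).
  have := card_poor_edges; have : #|F :&: poor_edges| = #|poor_edges|.
    congr #|pred_of_set _|; apply/setIidPr/subsetP => e.
    by rewrite inE => /andP[].
  have := cardsID poor_edges F; move: hcase.
  set N := _ ^ _ ; rewrite -!mulnA; set N' := _ * N; lia.
apply: leq_trans (_ : (4 * \sum_(R in dense_facets) #|nbr R|) ^ k <= _).
  by rewrite leq_exp2r.
rewrite expnMn -mulnA leq_mul2l; apply/orP; right.
have [j Ek] : exists j, k = j.+1 by exists k.-1; lia.
have := power_mean dense_facets (fun R => #|nbr R|) j; rewrite -Ek => /leq_trans; apply.
have hdf : #|dense_facets| <= #|T| ^ r.-1.
  apply: leq_trans card_facets; apply/subset_leq_card/subsetP => R.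
  by rewrite !inE => /andP[].
have hdf' : #|dense_facets| ^ j <= #|T| ^ (r.-1 * j).
  by rewrite expnM; case: (j) => // j'; rewrite leq_exp2r.
apply: leq_trans (leq_mul hdf' sum_dense_facets) _.
rewrite mulnCA -expnD leq_mul2l; apply/orP; right.
(* With [k = j.+1], the exponent [r.-1 * j + (r - 3 + k.+1)] is exactly [r * k - 1]. *)
by apply: leq_pexp2l => //; nia.
Qed.

End Counting.

(** * Greedy embedding of the expansion *)

Lemma subset_extend (T : finType) (B P : {set T}) s :
    B \subset P -> #|B| <= s -> s <= #|P| ->
  exists A : {set T}, [/\ B \subset A, A \subset P & #|A| = s].
Proof.
move=> sBP leBs lesP.
have cPB : #|P :\: B| = #|P| - #|B| by rewrite cardsD (setIidPr sBP).
have /card_gt0P[D] : 0 < #|[set D : {set T} | D \subset P :\: B & #|D| == s - #|B| ]|.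
  by rewrite cards_draws cPB bin_gt0 leq_sub2r.
rewrite inE subsetD => /andP[/andP[sDP dDB] /eqP cD].
exists (B :|: D); split; rewrite ?subsetUl ?subUset ?sBP //.
by move: dDB; rewrite disjoint_sym -leq_card_setU => /eqP ->; rewrite cD subnKC.
Qed.

(** Choose the sets one by one: [W] and the sets already chosen never occupy more than
    [#|W| + #|I| * q] points. *)
Lemma greedy_disjoint (I T : finType) (ok : I -> {set T} -> bool) (W : {set T}) q :
    (forall i S, ok i S -> #|S| = q) ->
    (forall i (U : {set T}), #|U| <= #|W| + #|I| * q ->
      exists2 S, ok i S & [disjoint S & U]) ->
  exists S : I -> {set T},
    [/\ forall i, ok i (S i), forall i, [disjoint S i & W] &
        forall i j, i != j -> [disjoint S i & S j]].
Proof.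
move=> okq okU.
suff [S hS] : exists S : I -> {set T}, forall i, i \in enum I ->
    [/\ ok i (S i), [disjoint S i & W] &
        forall j, j \in enum I -> i != j -> [disjoint S i & S j]].
  exists S; split=> [i|i|i j]; have [|? ? h] := hS i; rewrite ?mem_enum //.
  by apply: h; rewrite mem_enum.
have := enum_uniq I; elim: (enum I) => [|i L IH] /=; first by exists (fun=> set0).
case/andP=> iL uL; have [S hS] := IH uL.
pose U := W :|: \bigcup_(j in [set j in L]) S j.
have leU : #|U| <= #|W| + #|I| * q.
  apply: leq_trans (_ : _ <= #|W| + #|\bigcup_(j in [set j in L]) S j|) _.
    by rewrite cardsU leq_subr.
  rewrite leq_add2l; apply: leq_trans (leq_card_bigcup _ _) _.
  apply: (@leq_trans (\sum_(j in [set j in L]) q)).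
    by apply: leq_sum => j; rewrite inE => /hS[/okq ->].
  by rewrite sum_nat_const leq_mul2r max_card orbT.
have [Si okSi dSi] := okU i U leU.
have dSj j : j \in L -> [disjoint Si & S j].
  move=> jL; apply: disjointWr dSi; apply: subset_trans (subsetUr _ _).
  by apply: bigcup_sup; rewrite inE.
exists (fun j => if j == i then Si else S j) => j; rewrite inE.
have [-> _|nji /= jL] := eqVneq j i.
  split=> //; first by apply: disjointWr dSi; apply: subsetUl.
  move=> j'; rewrite inE; case: (eqVneq j' i) => [//|_ /= j'L _].
  exact: dSj.
have [okj dj hj] := hS j jL; split=> // j'; rewrite inE.
case: (eqVneq j' i) => [_ _ _|_ /= j'L njj']; last exact: hj.
by rewrite disjoint_sym dSj.
Qed.

(** Place [X] injectively in [P] and pad the image of each neighbourhood to an [s]-subset of [P].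
    This set is uncovered, so no set of at most as many points as the expansion has vertices meets
    its whole common link, and the blocks can be chosen greedily from the links. *)
Lemma expansion_copy (V T : finType) (e : rel V) (X Y : {set V}) r s
    (F : {set {set T}}) (P : {set T}) :
    symmetric e -> (forall y, y \in Y -> degree e y <= s) ->
    0 < s -> s <= #|P| -> #|X| <= #|P| ->
    (forall A : {set T}, A \subset P -> #|A| = s ->
      ~~ covered F r #|expansion_vertex X Y r| A) ->
  contains_copy (expansion e X Y r) F.
Proof.
move=> e_sym hdeg s0 lesP leXP hunc.
have /card_gt0P[t0 _] : 0 < #|P| by apply: leq_trans lesP.
pose phi (x : {x | x \in X}) : T := nth t0 (enum P) (enum_rank x).
have ltP (x : {x | x \in X}) : enum_rank x < size (enum P).
  rewrite -cardE; apply: leq_trans leXP; apply: leq_trans (ltn_ord _) _.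
  by rewrite card_sig.
have phiP x : phi x \in P by rewrite -mem_enum mem_nth.
have phi_inj : injective phi.
  move=> x x' /eqP; rewrite nth_uniq ?enum_uniq // => /eqP eqr.
  exact/enum_rank_inj/val_inj.
have exA (y : {y | y \in Y}) : exists A : {set T},
    [/\ phi @: [set x | e (val x) (val y)] \subset A, A \subset P & #|A| = s].
  apply: subset_extend => //.
    by apply/subsetP => _ /imsetP[x _ ->].
  rewrite card_imset //; apply: leq_trans (hdeg _ (valP y)).
  rewrite -(card_imset _ val_inj); apply/subset_leq_card/subsetP => _ /imsetP[x + ->].
  by rewrite !inE e_sym.
have [A hA] := fin_all_exists exA.
pose ok (y : {y | y \in Y}) (S : {set T}) := (#|S| == r.-1) && (A y \subset nbr F S).
have cVtx : #|expansion_vertex X Y r| = #|X| + #|{: {y | y \in Y}}| * r.-1.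
  by rewrite card_sum card_prod card_ord !card_sig.
have [|y U leU|S [hok hW hdis]] := @greedy_disjoint _ T ok [set phi x | x in setT] r.-1.
- by move=> y S /andP[/eqP].
- have [_ sAP cA] := hA y; have := hunc _ sAP cA; rewrite negb_exists.
  move/forallP/(_ U); rewrite cVtx negb_and.
  have -> : #|U| <= #|X| + #|{: {y | y \in Y}}| * r.-1.
    by apply: leq_trans leU _; rewrite card_imset // cardsT !card_sig.
  rewrite /= negb_forall => /existsP[S]; rewrite negb_imply negbK.
  by case/andP=> okS dS; exists S.
have cS y : size (enum (S y)) = r.-1 by rewrite -cardE; have /andP[/eqP] := hok y.
pose psi y (i : 'I_r.-1) : T := nth t0 (enum (S y)) i.
have psiS y i : psi y i \in S y by rewrite -mem_enum mem_nth // cS.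
pose f : {ffun expansion_vertex X Y r -> T} :=
  [ffun u => match u with inl x => phi x | inr (y, i) => psi y i end].
have phi_psi x y i : phi x <> psi y i.
  move=> eq_; have /pred0P/(_ (psi y i)) := hW y.
  by rewrite /= psiS -eq_ imset_f.
apply/existsP; exists f; apply/andP; split.
  apply/injectiveP => -[x|[y i]] [x'|[y' i']]; rewrite !ffunE.
  - by move/phi_inj ->.
  - by move/phi_psi.
  - by move/esym/phi_psi.
  move=> eq_; have eqy : y = y'.
    apply/eqP; apply: contraT => /hdis/pred0P/(_ (psi y i)).
    by rewrite /= psiS eq_ psiS.
  subst y'; congr (inr (_, _)); apply/val_inj/eqP; move/eqP: eq_.
  by rewrite nth_uniq ?cS ?enum_uniq.
apply/forall_inP => _ /imsetP[[x y] /= + ->]; rewrite inE /= => exy.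
have -> : f @: (inl x |: blowup X r y) = phi x |: S y.
  rewrite imsetU imset_set1 ffunE; congr (_ |: _).
  apply/setP => z; apply/imsetP/idP => [[_ /imsetP[i _ ->] ->]|zS].
    by rewrite ffunE.
  have hz : index z (enum (S y)) < r.-1 by rewrite -(cS y) index_mem mem_enum.
  exists (inr (y, Ordinal hz)); first exact: imset_f.
  by rewrite ffunE /psi nth_index ?mem_enum.
have /andP[_ /subsetP/(_ (phi x))] := hok y; rewrite inE => h.
suff /h/andP[] : phi x \in A y by [].
have [/subsetP sA _ _] := hA y; apply: sA; apply/imsetP.
by exists x; rewrite // inE.
Qed.

(** * Passage to real exponents and conclusion *)

Import Order.TTheory GRing.Theory Num.Theory.
Local Open Scope ring_scope.

(** Take [k]-th roots; since [1 <= K], the root of [K] is at most [K]. *)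
Lemma leq_powR_div (R : realType) (f K n a k : nat) :
    (0 < k)%N -> (0 < K)%N -> (1 <= a * k)%N -> (f ^ k <= K * n ^ (a * k - 1))%N ->
  f%:R <= K%:R * n%:R `^ (a%:R - k%:R^-1) :> R.
Proof.
move=> k0 K0 ak hf; have kR : k%:R != 0 :> R by rewrite pnatr_eq0 -lt0n.
have -> : f%:R = ((f ^ k)%N%:R `^ k%:R^-1) :> R.
  by rewrite natrX -powR_mulrn // -powRrM divff // powRr1.
have -> : n%:R `^ (a%:R - k%:R^-1) = ((n ^ (a * k - 1))%N%:R `^ k%:R^-1) :> R.
  rewrite natrX -powR_mulrn // -powRrM natrB // natrM; congr (_ `^ _).
  by rewrite mulrBl mulfK // mul1r.
apply: (@le_trans _ _ ((K * n ^ (a * k - 1))%N%:R `^ k%:R^-1)).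
  by rewrite ge0_ler_powR ?invr_ge0 ?nnegrE ?ler_nat.
rewrite natrM powRM // ler_wpM2r ?powR_ge0 //.
rewrite -[leRHS]powRr1 //; apply: ler_powR; first by rewrite ler1n.
by rewrite invf_le1 ?ltr0n // ler1n.
Qed.

Theorem theorem1p4 (R : realType) (V : finType) (e : rel V) (X Y : {set V})
    (r : nat) (he : simple_graph e) (hXY : bipartition e X Y)
    (hr : (3 <= r)%N) :
  exists C : R, forall s : nat, (2 <= s)%N ->
    (forall y, y \in Y -> (degree e y <= s)%N) ->
    forall n : nat, (0 < n)%N ->
      (ex r n (expansion e X Y r))%:R
        <= C * n%:R `^ (r%:R - (s%:R - 1)^-1).
Proof.
(* The least admissible s gives the best exponent, so its constant serves all. *)
pose k := (maxn 2 (\max_(y in Y) degree e y)).-1.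
have k0 : (0 < k)%N by rewrite /k -subn1 subn_gt0 leq_max.
have degk y : y \in Y -> (degree e y <= k.+1)%N.
  move=> yY; rewrite /k prednK ?leq_max //.
  by apply/orP; right; apply: (bigop.bigmax_sup y).
(* An [m]-set has room for [X] and for a [k.+1]-set; [M] bounds what the greedy embedding must
   avoid; [K] is the constant of [card_edges_bound]. *)
pose m := (#|X| + k.+1)%N; pose M := #|expansion_vertex X Y r|.
pose K := ((4 * (m + 2 * k.+1)) ^ k + 4 ^ k * (rich_const r k m * r * (k.+1 * M)))%N.
have K0 : (0 < K)%N by rewrite addn_gt0 expn_gt0 /m !addnS.
exists K%:R => s s2 degs n n0.
have le_ks : (k <= s.-1)%N.
  rewrite /k -!subn1 leq_sub2r // geq_max s2; apply/bigop.bigmax_leqP => y.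
  exact: degs.
(* As [k <= s.-1] and [1 <= n], the exponent formed with [k] gives the smaller bound. *)
apply: (@le_trans _ _ (K%:R * n%:R `^ (r%:R - k%:R^-1))); last first.
  rewrite ler_wpM2l // ler_powR ?ler1n // lerD2l lerN2.
  have -> : s%:R - 1 = s.-1%:R :> R by rewrite -subn1 natrB // ltnW.
  by rewrite lef_pV2 ?posrE ?ltr0n ?ler_nat // (leq_trans k0).
rewrite /ex; elim/big_ind: _ => [|x y hx hy|F /andP[uF nF]].
- by rewrite mulr_ge0 ?powR_ge0.
- by rewrite /maxn; case: ifP.
apply: leq_powR_div => //; first by rewrite muln_gt0 k0 (leq_trans _ hr).
have := @card_edges_bound 'I_n F r k m M uF hr k0; rewrite card_ord; apply=> //.
  by rewrite /m leq_addl.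
move=> P cP; suff /exists_inP[A sAP /andP[/eqP cA covA]] :
    [exists A : {set 'I_n} in powerset P, (#|A| == k.+1) && covered F r M A].
  by exists A; split=> //; rewrite -powersetE.
(* If [P] had no covered [k.+1]-subset, [expansion_copy] would embed the expansion in [F]. *)
apply: contraR nF; rewrite negb_exists_in => /forall_inP hP.
apply: (@expansion_copy V 'I_n e X Y r k.+1 F P) => //.
- by case: he.
- by rewrite cP leq_addl.
- by rewrite cP leq_addr.
move=> A sAP cA; have := hP A; rewrite powersetE => /(_ sAP).
by rewrite cA eqxx.
Qed.
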